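(* Let $f$ be the vector field of the planar equilateral circular restricted four body problem with equal masses $m_1=m_2=m_3=\frac13$. Let $\theta=\frac{2\pi}{3}$ and define two linear maps $\varphi^{\pm}:\mathbb{R}^4\to\mathbb{R}^4$ by $\varphi^{\pm}(\mathbf{x})=R^{\pm}\mathbf{x}$, where $\mathbf{x}=(x,\dot x,y,\dot y)$ and $$R^{\pm}=\begin{pmatrix}\cos(\pm\theta)&0&-\sin(\pm\theta)&0\\0&\cos(\pm\theta)&0&-\sin(\pm\theta)\\ \sin(\pm\theta)&0&\cos(\pm\theta)&0\\0&\sin(\pm\theta)&0&\cos(\pm\theta)\end{pmatrix}.$$ Then $\varphi^{\pm}$ is a rotational conjugacy for $f$: $\varphi^{\pm}\circ f(\mathbf{x})=f\circ\varphi^{\pm}(\mathbf{x})$ for all $\mathbf{x}\in\mathbb{R}^4$ at which $f$ is defined. In particular: (i) if $\gamma$ parameterizes a homoclinic orbit for $\mathcal{L}_0$, then $\varphi^{+}\circ\gamma$ and $\varphi^{-}\circ\gamma$ are parameterizations of two additional homoclinic orbits for $\mathcal{L}_0$, distinct from each other and from the orbit of $\gamma$; (ii) if $\gamma$ parameterizes a homoclinic orbit for $\mathcal{L}_5$, then $\varphi^{+}\circ\gamma$ and $\varphi^{-}\circ\gamma$ parameterize homoclinic orbits for the equilibria $\mathcal{L}_4$ and $\mathcal{L}_6$ (one for each of these two equilibria).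
   Context: Equal mass (triple Copenhagen) problem: the primaries are located at $P_1=(x_1,y_1)=(-\frac{\sqrt3}{3},0)$, $P_2=(x_2,y_2)=(\frac{\sqrt3}{6},-\frac12)$, $P_3=(x_3,y_3)=(\frac{\sqrt3}{6},\frac12)$, the vertices of an equilateral triangle centered at the origin. With $r_j(x,y)=\sqrt{(x-x_j)^2+(y-y_j)^2}$ and $$\Omega(x,y)=\tfrac12(x^2+y^2)+\tfrac13\left(\frac{1}{r_1(x,y)}+\frac{1}{r_2(x,y)}+\frac{1}{r_3(x,y)}\right),$$ the vector field is $$f(x,\dot x,y,\dot y)=\big(\dot x,\; 2\dot y+\Omega_x(x,y),\; \dot y,\; -2\dot x+\Omega_y(x,y)\big),$$ defined wherever $(x,y)\notin\{P_1,P_2,P_3\}$; here $\dot x,\dot y$ are coordinates on phase space and the subscripts on $\Omega$ denote partial derivatives. Equilibria (all have zero velocity components $\dot x=\dot y=0$, so they are described by their position $(x,y)$): $\mathcal{L}_0$ is the equilibrium at the origin. $\mathcal{L}_4,\mathcal{L}_5,\mathcal{L}_6$ are the three equilibria lying outside the triangle of the primaries on the rays from the origin through the midpoints of the sides of the triangle: $\mathcal{L}_5$ is the one on the positive $x$-axis (with $x>\frac{\sqrt3}{6}$), and $\mathcal{L}_6$, $\mathcal{L}_4$ are the corresponding ones on the rays of polar angle $\frac{2\pi}{3}$ and $-\frac{2\pi}{3}$, respectively. A homoclinic orbit for an equilibrium $\mathbf{x}_0$ is the orbit of a nonconstant solution $\gamma:\mathbb{R}\to\mathbb{R}^4$ of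 $\gamma'=f(\gamma)$ with $\lim_{t\to\pm\infty}\gamma(t)=\mathbf{x}_0$. *)

(* Defs.v *)
From Stdlib Require Import Reals.
From Coquelicot Require Import Coquelicot.
Open Scope R_scope.

(** Phase space R^4, coordinates ordered as (x, x', y, y'). *)
Definition state : Type := (R * R * R * R)%type.

Definition primary1 : R * R := (- (sqrt 3 / 3), 0).
Definition primary2 : R * R := (sqrt 3 / 6, - (1 / 2)).
Definition primary3 : R * R := (sqrt 3 / 6, 1 / 2).

Definition dist_to (P : R * R) (x y : R) : R :=
  sqrt ((x - fst P) ^ 2 + (y - snd P) ^ 2).

Definition Omega (x y : R) : R :=
  1 / 2 * (x ^ 2 + y ^ 2)
  + 1 / 3 * (1 / dist_to primary1 x y + 1 / dist_to primary2 x y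
             + 1 / dist_to primary3 x y).

Definition Omega_x (x y : R) : R := Derive (fun u => Omega u y) x.
Definition Omega_y (x y : R) : R := Derive (fun v => Omega x v) y.

(** [f] is a total function in Rocq, but is only meaningful on [dom_f]. *)
Definition dom_f (p : state) : Prop :=
  let '(x, _, y, _) := p in
  (x, y) <> primary1 /\ (x, y) <> primary2 /\ (x, y) <> primary3.

Definition f (p : state) : state :=
  let '(x, dx, y, dy) := p in
  (dx, 2 * dy + Omega_x x y, dy, - 2 * dx + Omega_y x y).

(** A 4 x 4 matrix is the tuple of its rows. *)
Definition matrix4 : Type := (state * state * state * state)%type.

Definition dot4 (u v : state) : R :=
  let '(u1, u2, u3, u4) := u in
  let '(v1, v2, v3, v4) := v in
  u1 * v1 + u2 * v2 + u3 * v3 + u4 * v4.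

Definition mulmv (M : matrix4) (v : state) : state :=
  let '(r1, r2, r3, r4) := M in (dot4 r1 v, dot4 r2 v, dot4 r3 v, dot4 r4 v).

Definition Rmat (a : R) : matrix4 :=
  ((cos a, 0,     - sin a, 0),
   (0,     cos a, 0,       - sin a),
   (sin a, 0,     cos a,   0),
   (0,     sin a, 0,       cos a)).

Definition theta : R := 2 * PI / 3.

Definition phi_plus (p : state) : state := mulmv (Rmat theta) p.
Definition phi_minus (p : state) : state := mulmv (Rmat (- theta)) p.

Definition rotational_conjugacy (phi : state -> state) : Prop :=
  forall p : state, dom_f p -> dom_f (phi p) /\ phi (f p) = f (phi p).

Definition equilibrium (p : state) : Prop := dom_f p /\ f p = (0, 0, 0, 0).

Definition is_solution (gamma : R -> state) : Prop :=
  forall t : R, dom_f (gamma t) /\ is_derive gamma t (f (gamma t)).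

(** [gamma] parameterizes a homoclinic orbit for [x0]. *)
Definition homoclinic (x0 : state) (gamma : R -> state) : Prop :=
  equilibrium x0 /\
  is_solution gamma /\
  (exists s t : R, gamma s <> gamma t) /\
  filterlim gamma (Rbar_locally p_infty) (locally x0) /\
  filterlim gamma (Rbar_locally m_infty) (locally x0).

Definition orbit (gamma : R -> state) (p : state) : Prop :=
  exists t : R, gamma t = p.

Definition distinct_orbits (g h : R -> state) : Prop :=
  ~ (forall p : state, orbit g p <-> orbit h p).

Definition L0 : state := (0, 0, 0, 0).

(** [p] is an equilibrium on the ray of polar angle [a], at distance more than
    [sqrt 3 / 6] from the origin.  That number is the inradius of the triangle
    of the primaries, so for [a] in {0, theta, - theta}, the directions of the
    midpoints of its sides, the points in question are those of the ray that
    lie outside the triangle. *)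
Definition outer_equilibrium (a : R) (p : state) : Prop :=
  equilibrium p /\
  exists r : R, sqrt 3 / 6 < r /\ p = (r * cos a, 0, r * sin a, 0).

Definition is_L5 : state -> Prop := outer_equilibrium 0.
Definition is_L6 : state -> Prop := outer_equilibrium theta.
Definition is_L4 : state -> Prop := outer_equilibrium (- theta).

(* Main.v *)
Require Import Defs.
From Stdlib Require Import Reals Lra.
From Coquelicot Require Import Coquelicot.
Open Scope R_scope.

(** The rotation by a third of a turn permutes the primaries, so it permutes the
    distances [r_1], [r_2], [r_3], and the gradient of [Omega] (computed in closed form) is
    equivariant; the Coriolis terms commute with every rotation.  This gives the
    conjugacy for [phi_plus] ([conjugacy_phi_plus]).  Everything about [phi_minus] follows
    since it is the square of [phi_plus], which has order three.  As [phi_plus] is linear and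
    injective, it carries homoclinic orbits for [x0] to homoclinic orbits for
    [phi_plus x0] ([homoclinic_phi_plus]).

    Distinctness of the orbits rests on uniqueness of solutions
    ([solution_unique]: local Lipschitz continuity of the gradient, Gronwall's
    inequality, connectedness of the line).  If the orbits of [phi_plus] o [g] and [g]
    agreed, then [phi_plus (g 0) = g s] for some [s], so by uniqueness
    [phi_plus (g t) = g (t + s)] for all [t], and applying this three times,
    [g t = g (t + 3 * s)].  If [s] is not [0], then [g] is periodic and has a limit, so it is
    constant.  If [s] is [0], then each [g t] is fixed by the rotation, so it is the origin.
    Both are excluded for a homoclinic orbit ([distinct_phi_plus]).  The other two pairs of
    orbits reduce to this case, because [phi_minus] o [g] is [phi_plus] o [phi_plus] o [g]
    and [phi_plus] o [phi_minus] o [g] is [g].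

    For the last part, the rotation maps the outer equilibrium on one ray to an outer
    equilibrium on the next, so it remains to see that the ray of angle [0] carries at most one
    ([outer_equilibrium_0_unique]).  With [x = sqrt 3 / 6 + u] and [u > 0],
      [Omega_x x 0 = x - 1/3 (x + sqrt 3 / 3)^-2 - 2/3 u (u^2 + 1/4)^(-3/2)],
    and [u (u^2 + 1/4)^(-3/2)] increases up to [u^2 = 1/8] and decreases afterwards.  The
    function is negative for [u^2 <= 1/8] and strictly increasing for [u^2 >= 1/8], hence
    has at most one zero. *)

(** * The rotation by a third of a turn *)

Lemma sqrt3_sqr : sqrt 3 * sqrt 3 = 3.
Proof. apply sqrt_sqrt; lra. Qed.

Lemma phi_plus_eq (x dx y dy : R) :
  phi_plus (x, dx, y, dy) =
  (- (1 / 2) * x - sqrt 3 / 2 * y, - (1 / 2) * dx - sqrt 3 / 2 * dy,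
   sqrt 3 / 2 * x - 1 / 2 * y, sqrt 3 / 2 * dx - 1 / 2 * dy).
Proof.
  unfold phi_plus, mulmv, Rmat, dot4, theta.
  replace (2 * PI / 3) with (2 * (PI / 3)) by field.
  rewrite cos_2PI3, sin_2PI3.
  repeat apply (f_equal2 pair); field.
Qed.

Lemma phi_minus_eq (p : state) : phi_minus p = phi_plus (phi_plus p).
Proof.
  destruct p as [[[x dx] y] dy].
  rewrite !phi_plus_eq.
  unfold phi_minus, mulmv, Rmat, dot4, theta.
  rewrite cos_neg, sin_neg.
  replace (2 * PI / 3) with (2 * (PI / 3)) by field.
  rewrite cos_2PI3, sin_2PI3.
  pose proof sqrt3_sqr as Hs.
  repeat apply (f_equal2 pair); field [Hs].
Qed.

Lemma phi_plus_cube (p : state) : phi_plus (phi_plus (phi_plus p)) = p.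
Proof.
  destruct p as [[[x dx] y] dy].
  rewrite !phi_plus_eq.
  pose proof sqrt3_sqr as Hs.
  repeat apply (f_equal2 pair); field [Hs].
Qed.

Lemma phi_plus_inj (p q : state) : phi_plus p = phi_plus q -> p = q.
Proof.
  intros E. rewrite <- (phi_plus_cube p), E. apply phi_plus_cube.
Qed.

Lemma phi_plus_0 : phi_plus (0, 0, 0, 0) = (0, 0, 0, 0).
Proof. rewrite phi_plus_eq. repeat apply (f_equal2 pair); ring. Qed.

Lemma phi_plus_fixed (p : state) : phi_plus p = p -> p = (0, 0, 0, 0).
Proof.
  destruct p as [[[x dx] y] dy].
  rewrite phi_plus_eq. intros E. injection E as E1 E2 E3 E4.
  pose proof sqrt3_sqr as Hs.
  assert (H0 : forall a b : R,
      - (1 / 2) * a - sqrt 3 / 2 * b = a -> sqrt 3 / 2 * a - 1 / 2 * b = b -> a = 0 /\ b = 0).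
  { intros a b Ha Hb.
    assert (H1 : sqrt 3 * (sqrt 3 * a) = 3 * a) by (rewrite <- Rmult_assoc, Hs; ring).
    replace (sqrt 3 * a) with (3 * b) in H1 by lra.
    assert (a = 0) as -> by lra. split; lra. }
  destruct (H0 x y E1 E3) as [-> ->], (H0 dx dy E2 E4) as [-> ->]. reflexivity.
Qed.

Lemma is_linear_comb {U : NormedModule R_AbsRing} (a b : R) (l m : U -> R) :
  is_linear l -> is_linear m -> is_linear (fun p => a * l p + b * m p).
Proof.
  intros Hl Hm.
  apply (is_linear_comp (fun p => (a * l p, b * m p)) (fun q : R * R => plus (fst q) (snd q)));
    [|exact (@is_linear_plus R_AbsRing R_NormedModule)].
  apply is_linear_prod.
  - apply (is_linear_comp l (fun r : R => scal a r)); [exact Hl|].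
    exact (@is_linear_scal_r R_AbsRing R_NormedModule _ Rmult_comm).
  - apply (is_linear_comp m (fun r : R => scal b r)); [exact Hm|].
    exact (@is_linear_scal_r R_AbsRing R_NormedModule _ Rmult_comm).
Qed.

(** The four coordinates of a state as linear forms. *)
Definition pos_x (p : state) : R := fst (fst (fst p)).
Definition vel_x (p : state) : R := snd (fst (fst p)).
Definition pos_y (p : state) : R := snd (fst p).
Definition vel_y (p : state) : R := snd p.

Lemma is_linear_fst_comp {T U V : NormedModule R_AbsRing} (l : T -> U * V) :
  is_linear l -> is_linear (fun t => fst (l t)).
Proof. intros H. apply (is_linear_comp l _ H), is_linear_fst. Qed.

Lemma is_linear_snd_comp {T U V : NormedModule R_AbsRing} (l : T -> U * V) :
  is_linear l -> is_linear (fun t => snd (l t)).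
Proof. intros H. apply (is_linear_comp l _ H), is_linear_snd. Qed.

Lemma is_linear_pos_x : is_linear pos_x.
Proof. apply is_linear_fst_comp, is_linear_fst_comp, is_linear_fst. Qed.

Lemma is_linear_vel_x : is_linear vel_x.
Proof. apply is_linear_snd_comp, is_linear_fst_comp, is_linear_fst. Qed.

Lemma is_linear_pos_y : is_linear pos_y.
Proof. apply is_linear_snd_comp, is_linear_fst. Qed.

Lemma is_linear_vel_y : is_linear vel_y.
Proof. apply is_linear_snd. Qed.

Lemma state_eq (p : state) : p = (pos_x p, vel_x p, pos_y p, vel_y p).
Proof. destruct p as [[[x dx] y] dy]. reflexivity. Qed.

Lemma is_linear_phi_plus : is_linear phi_plus.
Proof.
  set (l := fun p : state =>
    (- (1 / 2) * pos_x p + - (sqrt 3 / 2) * pos_y p,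
     - (1 / 2) * vel_x p + - (sqrt 3 / 2) * vel_y p,
     sqrt 3 / 2 * pos_x p + - (1 / 2) * pos_y p,
     sqrt 3 / 2 * vel_x p + - (1 / 2) * vel_y p)).
  assert (Hl : is_linear l).
  { repeat apply is_linear_prod; apply is_linear_comb;
      first [apply is_linear_pos_x | apply is_linear_pos_y
            | apply is_linear_vel_x | apply is_linear_vel_y]. }
  assert (E : forall p, phi_plus p = l p).
  { intros [[[x dx] y] dy]. rewrite phi_plus_eq. unfold l, pos_x, pos_y, vel_x, vel_y; simpl.
    repeat apply (f_equal2 pair); ring. }
  destruct Hl as [Hp Hs [M [HM Hn]]].
  split.
  - intros p q. rewrite !E. apply Hp.
  - intros k p. rewrite !E. apply Hs.
  - exists M. split; [exact HM|]. intros p. rewrite E. apply Hn.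
Qed.

Lemma is_derive_linear_comp {U V : NormedModule R_AbsRing} (l : U -> V) (g : R -> U)
    (t : R) (v : U) :
  is_linear l -> is_derive g t v -> is_derive (fun s => l (g s)) t (l v).
Proof.
  intros Hl Hg. unfold is_derive in *.
  apply (filterdiff_ext_lin _ (fun y : R => l (scal y v))).
  - apply (filterdiff_comp' g l t (fun y : R => scal y v) l Hg).
    apply filterdiff_linear, Hl.
  - intros y. apply (linear_scal l Hl).
Qed.

(** * The gradient of the potential *)

Lemma dist_to_nonneg (P : R * R) (x y : R) : 0 <= dist_to P x y.
Proof. apply sqrt_pos. Qed.

Lemma dist_to_sqr (P : R * R) (x y : R) :
  dist_to P x y * dist_to P x y = (x - fst P) ^ 2 + (y - snd P) ^ 2.
Proof. apply sqrt_sqrt, Rplus_le_le_0_compat; apply pow2_ge_0. Qed.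

Lemma dist_to_pos (P : R * R) (x y : R) : (x, y) <> P <-> 0 < dist_to P x y.
Proof.
  pose proof (dist_to_nonneg P x y) as H0.
  pose proof (dist_to_sqr P x y) as H1.
  destruct P as [a b]; simpl in H1. split.
  - intros H. destruct H0 as [H0 | H0]; [exact H0|]. exfalso; apply H.
    rewrite <- H0 in H1.
    pose proof (Rle_0_sqr (x - a)). pose proof (Rle_0_sqr (y - b)). unfold Rsqr in *.
    apply (f_equal2 pair); apply Rminus_diag_uniq, Rsqr_0_uniq; unfold Rsqr; lra.
  - intros H E. injection E as -> ->. nra.
Qed.

(** The configuration-space form of [dom_f]: no collision with a primary. *)
Definition dom_xy (x y : R) : Prop :=
  0 < dist_to primary1 x y /\ 0 < dist_to primary2 x y /\ 0 < dist_to primary3 x y.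

Lemma dom_f_xy (p : state) : dom_f p <-> dom_xy (pos_x p) (pos_y p).
Proof.
  destruct p as [[[x dx] y] dy]. unfold dom_xy, pos_x, pos_y; simpl.
  rewrite <- !dist_to_pos. reflexivity.
Qed.

Lemma is_derive_inv_dist_x (P : R * R) (x y : R) :
  0 < dist_to P x y ->
  is_derive (fun u => 1 / dist_to P u y) x (- ((x - fst P) / dist_to P x y ^ 3)).
Proof.
  intros H. unfold dist_to in *.
  assert (Hs : 0 < (x - fst P) ^ 2 + (y - snd P) ^ 2).
  { apply Rnot_le_lt. intros Hle. rewrite (sqrt_neg_0 _ Hle) in H. lra. }
  auto_derive.
  - simpl in *. unfold Rminus in *. repeat split; lra.
  - simpl in *. unfold Rminus in *. field. lra.
Qed.

Lemma is_derive_inv_dist_y (P : R * R) (x y : R) :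
  0 < dist_to P x y ->
  is_derive (fun v => 1 / dist_to P x v) y (- ((y - snd P) / dist_to P x y ^ 3)).
Proof.
  (* Exchanging the two axes reduces this to the derivative in x. *)
  assert (E : forall u v, dist_to P u v = dist_to (snd P, fst P) v u).
  { intros u v. unfold dist_to; simpl. f_equal. ring. }
  intros H. rewrite E in H |- *.
  apply (is_derive_ext (fun v => 1 / dist_to (snd P, fst P) v x)).
  - intros v. now rewrite E.
  - apply (is_derive_inv_dist_x (snd P, fst P)), H.
Qed.

(** The two components of the gradient of [Omega] in closed form, valid away from the
    primaries. *)
Definition grad_x (x y : R) : R :=
  x - 1 / 3 * ((x - fst primary1) / dist_to primary1 x y ^ 3
               + (x - fst primary2) / dist_to primary2 x y ^ 3
               + (x - fst primary3) / dist_to primary3 x y ^ 3).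

Definition grad_y (x y : R) : R :=
  y - 1 / 3 * ((y - snd primary1) / dist_to primary1 x y ^ 3
               + (y - snd primary2) / dist_to primary2 x y ^ 3
               + (y - snd primary3) / dist_to primary3 x y ^ 3).

Lemma is_derive_potential (q g1 g2 g3 : R -> R) (x q' l1 l2 l3 : R) :
  is_derive q x q' -> is_derive g1 x l1 -> is_derive g2 x l2 -> is_derive g3 x l3 ->
  is_derive (fun u => 1 / 2 * q u + 1 / 3 * (g1 u + g2 u + g3 u)) x
    (1 / 2 * q' + 1 / 3 * (l1 + l2 + l3)).
Proof.
  intros Hq H1 H2 H3.
  apply (is_derive_plus (fun u => 1 / 2 * q u) (fun u => 1 / 3 * (g1 u + g2 u + g3 u))).
  - now apply is_derive_scal.
  - apply is_derive_scal.
    apply (is_derive_plus (fun u => g1 u + g2 u) g3); [|exact H3].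
    now apply (is_derive_plus g1 g2).
Qed.

Lemma Omega_x_eq (x y : R) : dom_xy x y -> Omega_x x y = grad_x x y.
Proof.
  intros [H1 [H2 H3]]. apply is_derive_unique.
  assert (Hq : is_derive (fun u => u ^ 2 + y ^ 2) x (2 * x)) by (auto_derive; [exact I | ring]).
  pose proof (is_derive_potential _ _ _ _ _ _ _ _ _ Hq (is_derive_inv_dist_x primary1 x y H1)
    (is_derive_inv_dist_x primary2 x y H2) (is_derive_inv_dist_x primary3 x y H3)) as H.
  replace (grad_x x y) with
    (1 / 2 * (2 * x) + 1 / 3 *
       (- ((x - fst primary1) / dist_to primary1 x y ^ 3)
        + - ((x - fst primary2) / dist_to primary2 x y ^ 3)
        + - ((x - fst primary3) / dist_to primary3 x y ^ 3))).
  - exact H.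
  - unfold grad_x. field. repeat split; apply Rgt_not_eq; assumption.
Qed.

Lemma Omega_y_eq (x y : R) : dom_xy x y -> Omega_y x y = grad_y x y.
Proof.
  intros [H1 [H2 H3]]. apply is_derive_unique.
  assert (Hq : is_derive (fun v => x ^ 2 + v ^ 2) y (2 * y)) by (auto_derive; [exact I | ring]).
  pose proof (is_derive_potential _ _ _ _ _ _ _ _ _ Hq (is_derive_inv_dist_y primary1 x y H1)
    (is_derive_inv_dist_y primary2 x y H2) (is_derive_inv_dist_y primary3 x y H3)) as H.
  replace (grad_y x y) with
    (1 / 2 * (2 * y) + 1 / 3 *
       (- ((y - snd primary1) / dist_to primary1 x y ^ 3)
        + - ((y - snd primary2) / dist_to primary2 x y ^ 3)
        + - ((y - snd primary3) / dist_to primary3 x y ^ 3))).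
  - exact H.
  - unfold grad_y. field. repeat split; apply Rgt_not_eq; assumption.
Qed.

Lemma f_eq (p : state) :
  dom_f p ->
  Defs.f p = (vel_x p, 2 * vel_y p + grad_x (pos_x p) (pos_y p),
         vel_y p, - 2 * vel_x p + grad_y (pos_x p) (pos_y p)).
Proof.
  intros H. apply dom_f_xy in H. destruct p as [[[x dx] y] dy].
  unfold Defs.f. rewrite Omega_x_eq, Omega_y_eq by exact H. reflexivity.
Qed.

(** * The conjugacy *)

(** The rotation of the plane by [theta]; [phi_plus] applies it to the position and to
    the velocity. *)
Definition rot_x (x y : R) : R := - (1 / 2) * x - sqrt 3 / 2 * y.
Definition rot_y (x y : R) : R := sqrt 3 / 2 * x - 1 / 2 * y.

(** The rotation permutes the primaries cyclically. *)
Lemma dist_to_rot (x y : R) :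
  dist_to primary1 (rot_x x y) (rot_y x y) = dist_to primary3 x y /\
  dist_to primary2 (rot_x x y) (rot_y x y) = dist_to primary1 x y /\
  dist_to primary3 (rot_x x y) (rot_y x y) = dist_to primary2 x y.
Proof.
  pose proof sqrt3_sqr as Hs.
  unfold dist_to, rot_x, rot_y; simpl.
  repeat split; f_equal; field [Hs].
Qed.

Lemma dom_xy_rot (x y : R) : dom_xy x y -> dom_xy (rot_x x y) (rot_y x y).
Proof.
  unfold dom_xy. destruct (dist_to_rot x y) as [-> [-> ->]]. tauto.
Qed.

Lemma grad_rot (x y : R) :
  dom_xy x y ->
  grad_x (rot_x x y) (rot_y x y) = rot_x (grad_x x y) (grad_y x y) /\
  grad_y (rot_x x y) (rot_y x y) = rot_y (grad_x x y) (grad_y x y).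
Proof.
  intros [H1 [H2 H3]].
  pose proof sqrt3_sqr as Hs.
  unfold grad_x, grad_y. destruct (dist_to_rot x y) as [-> [-> ->]].
  set (d1 := dist_to primary1 x y) in *. set (d2 := dist_to primary2 x y) in *.
  set (d3 := dist_to primary3 x y) in *. clearbody d1 d2 d3.
  unfold rot_x, rot_y; simpl.
  split; field [Hs]; repeat split; lra.
Qed.

Lemma conjugacy_phi_plus : rotational_conjugacy phi_plus.
Proof.
  intros p Hp. pose proof (proj1 (dom_f_xy p) Hp) as H.
  assert (Hd : dom_f (phi_plus p)).
  { apply dom_f_xy. rewrite (state_eq p), phi_plus_eq. apply (dom_xy_rot _ _ H). }
  split; [exact Hd|].
  rewrite (f_eq _ Hp), (f_eq _ Hd), phi_plus_eq.
  destruct p as [[[x dx] y] dy]. rewrite phi_plus_eq.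
  unfold pos_x, pos_y, vel_x, vel_y in *; simpl in *.
  destruct (grad_rot x y H) as [Ex Ey]. unfold rot_x, rot_y in Ex, Ey.
  rewrite Ex, Ey. repeat apply (f_equal2 pair); ring.
Qed.

Lemma conjugacy_phi_minus : rotational_conjugacy phi_minus.
Proof.
  intros p Hp. rewrite !phi_minus_eq.
  destruct (conjugacy_phi_plus p Hp) as [H1 E1].
  destruct (conjugacy_phi_plus _ H1) as [H2 E2].
  split; [exact H2|]. now rewrite E1, E2.
Qed.

(** * Transport of homoclinic orbits *)

Lemma equilibrium_phi_plus (p : state) : equilibrium p -> equilibrium (phi_plus p).
Proof.
  intros [Hd Hf]. destruct (conjugacy_phi_plus p Hd) as [H E].
  split; [exact H|]. rewrite <- E, Hf. apply phi_plus_0.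
Qed.

Lemma is_solution_phi_plus (g : R -> state) :
  is_solution g -> is_solution (fun t => phi_plus (g t)).
Proof.
  intros H t. destruct (H t) as [Hd Hg].
  destruct (conjugacy_phi_plus _ Hd) as [Hd' E]. split; [exact Hd'|].
  rewrite <- E. exact (is_derive_linear_comp phi_plus g t _ is_linear_phi_plus Hg).
Qed.

Lemma homoclinic_phi_plus (x0 : state) (g : R -> state) :
  homoclinic x0 g -> homoclinic (phi_plus x0) (fun t => phi_plus (g t)).
Proof.
  intros [He [Hs [[s [t Hst]] [Hp Hm]]]].
  pose proof (linear_cont phi_plus x0 is_linear_phi_plus) as Hc.
  split; [now apply equilibrium_phi_plus|].
  split; [now apply is_solution_phi_plus|].
  split; [exists s, t; intros E; apply Hst, phi_plus_inj, E|].
  split; eapply filterlim_comp; eassumption.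
Qed.

Lemma homoclinic_ext (x0 : state) (g h : R -> state) :
  (forall t, g t = h t) -> homoclinic x0 g -> homoclinic x0 h.
Proof.
  intros E [He [Hs [[s [t Hst]] [Hp Hm]]]].
  split; [exact He|]. split; [|split; [|split]].
  - intros u. destruct (Hs u) as [Hd Hg]. rewrite <- E. split; [exact Hd|].
    now apply (is_derive_ext g).
  - exists s, t. now rewrite <- !E.
  - now apply (filterlim_ext g).
  - now apply (filterlim_ext g).
Qed.

Lemma homoclinic_phi_minus (x0 : state) (g : R -> state) :
  homoclinic x0 g -> homoclinic (phi_minus x0) (fun t => phi_minus (g t)).
Proof.
  intros H. rewrite phi_minus_eq.
  apply (homoclinic_ext _ (fun t => phi_plus (phi_plus (g t)))).
  - intros t. now rewrite phi_minus_eq.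
  - now apply (homoclinic_phi_plus (phi_plus x0) (fun t => phi_plus (g t))),
      homoclinic_phi_plus.
Qed.

(** * The equilibrium on the positive half-axis *)

(** Relative to [primary2] and [primary3], the point [(sqrt 3 / 6 + u, 0)] has abscissa [u] and
    squared distance [u ^ 2 + 1 / 4]. *)
Lemma grad_x_axis (u d : R) :
  0 < u -> 0 < d -> d * d = u ^ 2 + 1 / 4 ->
  grad_x (sqrt 3 / 6 + u) 0
  = sqrt 3 / 6 + u - 1 / 3 * (1 / (sqrt 3 / 2 + u) ^ 2) - 2 / 3 * (u / d ^ 3).
Proof.
  intros Hu Hd Ed.
  assert (H3 : 0 < sqrt 3) by (apply sqrt_lt_R0; lra).
  unfold grad_x.
  replace (dist_to primary1 (sqrt 3 / 6 + u) 0) with (sqrt 3 / 2 + u).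
  2:{ symmetry. apply sqrt_lem_1; simpl; nra. }
  assert (E : forall b, b * b = 1 / 4 -> dist_to (sqrt 3 / 6, b) (sqrt 3 / 6 + u) 0 = d).
  { intros b Hb. apply sqrt_lem_1; simpl; [nra | lra | nra]. }
  unfold primary2, primary3. rewrite !E by lra. simpl. field. lra.
Qed.

Lemma radius_exists (u : R) : exists d, 0 < d /\ d * d = u ^ 2 + 1 / 4.
Proof.
  pose proof (pow2_ge_0 u).
  exists (sqrt (u ^ 2 + 1 / 4)). split; [apply sqrt_lt_R0; lra | apply sqrt_sqrt; lra].
Qed.

Lemma sqrt3_bounds : 17 / 10 < sqrt 3 < 7 / 4.
Proof.
  pose proof sqrt3_sqr. pose proof (sqrt_pos 3). split; nra.
Qed.

(** The two near primaries dominate close to the side of the triangle. *)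
Lemma grad_x_axis_neg (u : R) :
  0 < u -> u ^ 2 <= 1 / 8 -> grad_x (sqrt 3 / 6 + u) 0 < 0.
Proof.
  intros Hu Hu2. destruct (radius_exists u) as [d [Hd Ed]].
  rewrite (grad_x_axis u d Hu Hd Ed).
  destruct sqrt3_bounds as [S1 S2].
  (* [d * d <= 3/8] gives [d <= 5/8] and [d ^ 3 <= 15/64]. *)
  assert (Hd2 : d <= 5 / 8) by nra.
  assert (Hd3 : d ^ 3 <= 1 / 4).
  { replace (d ^ 3) with ((d * d) * d) by ring. nra. }
  assert (Hd0 : 0 < d ^ 3) by now apply pow_lt.
  assert (A : 4 * u <= u / d ^ 3).
  { apply Rmult_le_reg_r with (d ^ 3); [exact Hd0|].
    unfold Rdiv. rewrite (Rmult_assoc u), Rinv_l by lra. nra. }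
  assert (Hu1 : u <= 2 / 5) by nra.
  (* By the bound [A] it suffices that [sqrt 3 / 6 + u - 8/3 u] is less than the pull of
     [primary1], which is at distance [c] from the point. *)
  set (c := sqrt 3 / 2 + u).
  assert (C1 : 0 < c <= 7 / 8 + u) by (unfold c; lra).
  assert (B : sqrt 3 / 6 + u - 8 / 3 * u < 1 / 3 * (1 / c ^ 2)).
  { apply Rmult_lt_reg_r with (c ^ 2); [now apply pow_lt; apply C1|].
    replace (1 / 3 * (1 / c ^ 2) * c ^ 2) with (1 / 3) by (field; lra).
    apply Rle_lt_trans with ((7 / 24 - 5 / 3 * u) * c ^ 2).
    - apply Rmult_le_compat_r; [apply pow2_ge_0|lra].
    - destruct (Rle_or_lt (7 / 24 - 5 / 3 * u) 0); [nra|].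
      apply Rle_lt_trans with ((7 / 24 - 5 / 3 * u) * (7 / 8 + u) ^ 2).
      + apply Rmult_le_compat_l; [lra|]. apply pow_incr; lra.
      + nra. }
  lra.
Qed.

Lemma grad_x_axis_lt (u1 u2 : R) :
  0 < u1 -> 1 / 8 <= u1 ^ 2 -> u1 < u2 ->
  grad_x (sqrt 3 / 6 + u1) 0 < grad_x (sqrt 3 / 6 + u2) 0.
Proof.
  intros Hu1 Hw Hlt. assert (Hu2 : 0 < u2) by lra.
  destruct (radius_exists u1) as [d1 [Hd1 Ed1]], (radius_exists u2) as [d2 [Hd2 Ed2]].
  rewrite (grad_x_axis u1 d1 Hu1 Hd1 Ed1), (grad_x_axis u2 d2 Hu2 Hd2 Ed2).
  destruct sqrt3_bounds as [S1 S2].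
  assert (A : 1 / (sqrt 3 / 2 + u2) ^ 2 <= 1 / (sqrt 3 / 2 + u1) ^ 2).
  { unfold Rdiv. rewrite !Rmult_1_l. apply Rinv_le_contravar; [apply pow_lt; lra|].
    apply pow_incr; lra. }
  assert (P1 : 0 < d1 ^ 3) by now apply pow_lt.
  assert (P2 : 0 < d2 ^ 3) by now apply pow_lt.
  (* The function [u / d ^ 3] decreases: compare squares, as polynomials in [w = u ^ 2].
     The bracket below vanishes at [w1 = w2 = 1/8]. *)
  assert (B : u2 * d1 ^ 3 <= u1 * d2 ^ 3).
  { apply Rsqr_incr_0_var; [|nra]. unfold Rsqr.
    replace (u2 * d1 ^ 3 * (u2 * d1 ^ 3)) with (u2 ^ 2 * (d1 * d1) ^ 3) by ring.
    replace (u1 * d2 ^ 3 * (u1 * d2 ^ 3)) with (u1 ^ 2 * (d2 * d2) ^ 3) by ring.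
    rewrite Ed1, Ed2.
    assert (Hww : u1 ^ 2 <= u2 ^ 2) by (apply pow_incr; lra).
    set (w1 := u1 ^ 2) in *. set (w2 := u2 ^ 2) in *. clearbody w1 w2.
    apply Rminus_le_0.
    replace (w1 * (w2 + 1 / 4) ^ 3 - w2 * (w1 + 1 / 4) ^ 3)
      with ((w2 - w1) * (w1 * w2 * (w1 + w2) + 3 / 4 * (w1 * w2) - 1 / 64)) by field.
    apply Rmult_le_pos; [lra|].
    assert (1 / 64 <= w1 * w2) by nra. nra. }
  assert (C : u2 / d2 ^ 3 <= u1 / d1 ^ 3).
  { apply Rmult_le_reg_r with (d1 ^ 3 * d2 ^ 3); [nra|].
    replace (u2 / d2 ^ 3 * (d1 ^ 3 * d2 ^ 3)) with (u2 * d1 ^ 3) by (field; lra).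
    replace (u1 / d1 ^ 3 * (d1 ^ 3 * d2 ^ 3)) with (u1 * d2 ^ 3) by (field; lra).
    exact B. }
  lra.
Qed.

Lemma grad_x_axis_zero_unique (r1 r2 : R) :
  sqrt 3 / 6 < r1 -> sqrt 3 / 6 < r2 -> grad_x r1 0 = 0 -> grad_x r2 0 = 0 -> r1 = r2.
Proof.
  assert (K : forall a b, sqrt 3 / 6 < a -> grad_x a 0 = 0 -> grad_x b 0 = 0 -> ~ a < b).
  { intros a b Ha Ea Eb Hab.
    replace a with (sqrt 3 / 6 + (a - sqrt 3 / 6)) in Ea by ring.
    replace b with (sqrt 3 / 6 + (b - sqrt 3 / 6)) in Eb by ring.
    destruct (Rle_or_lt ((a - sqrt 3 / 6) ^ 2) (1 / 8)) as [Hle | Hlt].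
    - pose proof (grad_x_axis_neg (a - sqrt 3 / 6) ltac:(lra) Hle). lra.
    - pose proof (grad_x_axis_lt (a - sqrt 3 / 6) (b - sqrt 3 / 6)
        ltac:(lra) ltac:(lra) ltac:(lra)). lra. }
  intros H1 H2 E1 E2.
  destruct (Rtotal_order r1 r2) as [H | [H | H]]; [|exact H|].
  - now destruct (K r1 r2 H1 E1 E2).
  - now destruct (K r2 r1 H2 E2 E1).
Qed.

Lemma outer_equilibrium_0_unique (p q : state) :
  outer_equilibrium 0 p -> outer_equilibrium 0 q -> p = q.
Proof.
  intros [[Dp Fp] [r1 [H1 E1]]] [[Dq Fq] [r2 [H2 E2]]].
  rewrite cos_0, sin_0, Rmult_1_r, Rmult_0_r in E1, E2.
  rewrite f_eq in Fp, Fq by assumption. subst p q.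
  unfold pos_x, pos_y, vel_x, vel_y in Fp, Fq; simpl in Fp, Fq.
  injection Fp as Fp _. injection Fq as Fq _.
  rewrite (grad_x_axis_zero_unique r1 r2); [reflexivity | assumption | assumption | lra | lra].
Qed.

Lemma phi_minus_outer (p : state) : outer_equilibrium theta p -> outer_equilibrium 0 (phi_minus p).
Proof.
  intros [He [r [Hr E]]]. split.
  - rewrite phi_minus_eq. now apply equilibrium_phi_plus, equilibrium_phi_plus.
  - exists r. split; [exact Hr|]. subst p. unfold phi_minus, mulmv, Rmat, dot4.
    rewrite cos_neg, sin_neg, cos_0, sin_0.
    pose proof (sin2_cos2 theta) as H. unfold Rsqr in H.
    repeat apply (f_equal2 pair); try ring.
    replace (_ + _) with (r * (sin theta * sin theta + cos theta * cos theta)) by ring.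
    now rewrite H.
Qed.

Lemma phi_plus_outer (p : state) : outer_equilibrium (- theta) p -> outer_equilibrium 0 (phi_plus p).
Proof.
  intros [He [r [Hr E]]]. split.
  - now apply equilibrium_phi_plus.
  - exists r. split; [exact Hr|]. subst p. unfold phi_plus, mulmv, Rmat, dot4.
    rewrite cos_neg, sin_neg, cos_0, sin_0.
    pose proof (sin2_cos2 theta) as H. unfold Rsqr in H.
    repeat apply (f_equal2 pair); try ring.
    replace (_ + _) with (r * (sin theta * sin theta + cos theta * cos theta)) by ring.
    now rewrite H.
Qed.

(** * Local Lipschitz continuity of the gradient *)

(** [(u, v)] lies in the open square of centre [(x, y)] and half-side [d]. *)
Definition near (d x y u v : R) : Prop := Rabs (u - x) < d /\ Rabs (v - y) < d.

(** Lipschitz continuity on some square around [(x, y)], with respect to the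
    1-norm of the plane. *)
Definition locally_lipschitz (g : R -> R -> R) (x y : R) : Prop :=
  exists d L : R, 0 < d /\ 0 <= L /\
    forall x1 y1 x2 y2 : R, near d x y x1 y1 -> near d x y x2 y2 ->
      Rabs (g x1 y1 - g x2 y2) <= L * (Rabs (x1 - x2) + Rabs (y1 - y2)).

Lemma near_le {d d' x y u v : R} : d <= d' -> near d x y u v -> near d' x y u v.
Proof. intros H [H1 H2]. split; lra. Qed.

Lemma near_center (d x y : R) : 0 < d -> near d x y x y.
Proof. intros H. split; rewrite Rminus_diag, Rabs_R0; exact H. Qed.

Lemma lipschitz_continuous (g : R -> R -> R) (x y : R) :
  locally_lipschitz g x y ->
  forall e : R, 0 < e -> exists d : R, 0 < d /\
    forall u v, near d x y u v -> Rabs (g u v - g x y) < e.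
Proof.
  intros [d [L [Hd [HL H]]]] e He.
  assert (He' : 0 < e / (2 * (L + 1))) by (apply Rdiv_lt_0_compat; lra).
  exists (Rmin d (e / (2 * (L + 1)))). split; [now apply Rmin_glb_lt|].
  intros u v Huv.
  pose proof (near_le (Rmin_l _ _) Huv) as H1.
  destruct (near_le (Rmin_r _ _) Huv) as [H2 H3].
  eapply Rle_lt_trans; [apply (H u v x y H1), near_center, Hd|].
  apply Rle_lt_trans with ((L + 1) * (Rabs (u - x) + Rabs (v - y))).
  - apply Rmult_le_compat_r; [|lra].
    apply Rplus_le_le_0_compat; apply Rabs_pos.
  - apply Rlt_le_trans with ((L + 1) * (e / (2 * (L + 1)) + e / (2 * (L + 1)))).
    + apply Rmult_lt_compat_l; lra.
    + apply Req_le. field. lra.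
Qed.

Lemma lipschitz_ext (g h : R -> R -> R) (x y : R) :
  (forall u v, g u v = h u v) -> locally_lipschitz g x y -> locally_lipschitz h x y.
Proof.
  intros E [d [L [Hd [HL H]]]]. exists d, L. split; [exact Hd|]. split; [exact HL|].
  intros. rewrite <- !E. now apply H.
Qed.

Lemma lipschitz_coord_x (c x y : R) : locally_lipschitz (fun u _ => u - c) x y.
Proof.
  exists 1, 1. split; [lra|]. split; [lra|]. intros x1 y1 x2 y2 _ _.
  replace (x1 - c - (x2 - c)) with (x1 - x2) by ring.
  pose proof (Rabs_pos (y1 - y2)). lra.
Qed.

Lemma lipschitz_coord_y (c x y : R) : locally_lipschitz (fun _ v => v - c) x y.
Proof.
  exists 1, 1. split; [lra|]. split; [lra|]. intros x1 y1 x2 y2 _ _.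
  replace (y1 - c - (y2 - c)) with (y1 - y2) by ring.
  pose proof (Rabs_pos (x1 - x2)). lra.
Qed.

Lemma lipschitz_scal (k : R) (g : R -> R -> R) (x y : R) :
  locally_lipschitz g x y -> locally_lipschitz (fun u v => k * g u v) x y.
Proof.
  intros [d [L [Hd [HL H]]]]. exists d, (Rabs k * L). split; [exact Hd|]. split.
  - apply Rmult_le_pos; [apply Rabs_pos | exact HL].
  - intros x1 y1 x2 y2 H1 H2. rewrite <- Rmult_minus_distr_l, Rabs_mult, Rmult_assoc.
    apply Rmult_le_compat_l; [apply Rabs_pos | now apply H].
Qed.

Lemma lipschitz_plus (g h : R -> R -> R) (x y : R) :
  locally_lipschitz g x y -> locally_lipschitz h x y ->
  locally_lipschitz (fun u v => g u v + h u v) x y.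
Proof.
  intros [d [L [Hd [HL H]]]] [d' [L' [Hd' [HL' H']]]].
  exists (Rmin d d'), (L + L'). split; [now apply Rmin_glb_lt|]. split; [lra|].
  intros x1 y1 x2 y2 H1 H2.
  specialize (H _ _ _ _ (near_le (Rmin_l _ _) H1) (near_le (Rmin_l _ _) H2)).
  specialize (H' _ _ _ _ (near_le (Rmin_r _ _) H1) (near_le (Rmin_r _ _) H2)).
  replace (g x1 y1 + h x1 y1 - (g x2 y2 + h x2 y2))
    with ((g x1 y1 - g x2 y2) + (h x1 y1 - h x2 y2)) by ring.
  eapply Rle_trans; [apply Rabs_triang|]. lra.
Qed.

Lemma lipschitz_mult (g h : R -> R -> R) (x y : R) :
  locally_lipschitz g x y -> locally_lipschitz h x y ->
  locally_lipschitz (fun u v => g u v * h u v) x y.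
Proof.
  intros Hg Hh.
  destruct (lipschitz_continuous g x y Hg 1 Rlt_0_1) as [dg [Hdg Bg]].
  destruct (lipschitz_continuous h x y Hh 1 Rlt_0_1) as [dh [Hdh Bh]].
  destruct Hg as [d [L [Hd [HL H]]]], Hh as [d' [L' [Hd' [HL' H']]]].
  set (G := Rabs (g x y) + 1). set (K := Rabs (h x y) + 1).
  assert (HG : 0 < G) by (pose proof (Rabs_pos (g x y)); unfold G; lra).
  assert (HK : 0 < K) by (pose proof (Rabs_pos (h x y)); unfold K; lra).
  set (m1 := Rmin dg dh). set (m2 := Rmin d d').
  assert (M1 : m1 <= dg /\ m1 <= dh) by (split; [apply Rmin_l | apply Rmin_r]).
  assert (M2 : m2 <= d /\ m2 <= d') by (split; [apply Rmin_l | apply Rmin_r]).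
  assert (P1 : 0 < m1) by now apply Rmin_glb_lt.
  assert (P2 : 0 < m2) by now apply Rmin_glb_lt.
  clearbody m1 m2.
  exists (Rmin m1 m2), (G * L' + K * L).
  split; [now apply Rmin_glb_lt|]. split.
  { apply Rplus_le_le_0_compat; apply Rmult_le_pos; lra. }
  intros x1 y1 x2 y2 H1 H2.
  pose proof (near_le (Rmin_l _ _) H1) as N1. pose proof (near_le (Rmin_r _ _) H1) as N1'.
  pose proof (near_le (Rmin_l _ _) H2) as N2. pose proof (near_le (Rmin_r _ _) H2) as N2'.
  assert (B1 : Rabs (g x1 y1) <= G).
  { pose proof (Bg _ _ (near_le (proj1 M1) N1)).
    pose proof (Rabs_triang_inv (g x1 y1) (g x y)). unfold G. lra. }
  assert (B2 : Rabs (h x2 y2) <= K).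
  { pose proof (Bh _ _ (near_le (proj2 M1) N2)).
    pose proof (Rabs_triang_inv (h x2 y2) (h x y)). unfold K. lra. }
  specialize (H _ _ _ _ (near_le (proj1 M2) N1') (near_le (proj1 M2) N2')).
  specialize (H' _ _ _ _ (near_le (proj2 M2) N1') (near_le (proj2 M2) N2')).
  replace (g x1 y1 * h x1 y1 - g x2 y2 * h x2 y2)
    with (g x1 y1 * (h x1 y1 - h x2 y2) + h x2 y2 * (g x1 y1 - g x2 y2)) by ring.
  eapply Rle_trans; [apply Rabs_triang|]. rewrite !Rabs_mult.
  rewrite Rmult_plus_distr_r, !Rmult_assoc.
  apply Rplus_le_compat; apply Rmult_le_compat; try apply Rabs_pos; assumption.
Qed.

Lemma lipschitz_inv (g : R -> R -> R) (x y : R) :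
  0 < g x y -> locally_lipschitz g x y -> locally_lipschitz (fun u v => / g u v) x y.
Proof.
  intros Hp Hg. set (m := g x y / 2).
  assert (Hm : 0 < m) by (unfold m; lra).
  destruct (lipschitz_continuous g x y Hg m Hm) as [d' [Hd' B]].
  destruct Hg as [d [L [Hd [HL H]]]].
  pose proof (Rinv_0_lt_compat m Hm) as Hm'.
  exists (Rmin d d'), (/ m * / m * L). split; [now apply Rmin_glb_lt|]. split.
  { repeat apply Rmult_le_pos; lra. }
  intros x1 y1 x2 y2 H1 H2.
  assert (low : forall u v, near (Rmin d d') x y u v -> m < g u v).
  { intros u v N. specialize (B _ _ (near_le (Rmin_r _ _) N)).
    apply Rabs_def2 in B. unfold m in *. lra. }
  specialize (H _ _ _ _ (near_le (Rmin_l _ _) H1) (near_le (Rmin_l _ _) H2)).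
  pose proof (low _ _ H1) as L1. pose proof (low _ _ H2) as L2.
  replace (/ g x1 y1 - / g x2 y2) with (/ g x1 y1 * / g x2 y2 * - (g x1 y1 - g x2 y2))
    by (field; lra).
  assert (I1 : 0 < / g x1 y1) by (apply Rinv_0_lt_compat; lra).
  assert (I2 : 0 < / g x2 y2) by (apply Rinv_0_lt_compat; lra).
  assert (J1 : / g x1 y1 <= / m) by (apply Rinv_le_contravar; lra).
  assert (J2 : / g x2 y2 <= / m) by (apply Rinv_le_contravar; lra).
  assert (I12 : 0 < / g x1 y1 * / g x2 y2) by now apply Rmult_lt_0_compat.
  rewrite Rabs_mult, Rabs_Ropp, (Rabs_pos_eq (_ * _)) by lra.
  rewrite (Rmult_assoc (/ m * / m)).
  apply Rmult_le_compat; [lra | apply Rabs_pos | | exact H].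
  apply Rmult_le_compat; lra.
Qed.

Lemma Rabs_le_hypotenuse (a b r : R) : 0 <= r -> r * r = a ^ 2 + b ^ 2 -> Rabs a <= r.
Proof.
  intros Hr E. apply Rsqr_incr_0_var; [|exact Hr]. rewrite <- Rsqr_abs.
  unfold Rsqr. rewrite E. pose proof (pow2_ge_0 b). lra.
Qed.

(** The distance to [P] is 1-Lipschitz for the 1-norm, which dominates the Euclidean one. *)
Lemma dist_to_triangle (P : R * R) (x1 y1 x2 y2 : R) :
  dist_to P x1 y1 <= dist_to P x2 y2 + (Rabs (x1 - x2) + Rabs (y1 - y2)).
Proof.
  pose proof (dist_to_nonneg P x2 y2) as N.
  pose proof (dist_to_sqr P x1 y1) as S1. pose proof (dist_to_sqr P x2 y2) as S2.
  set (r := dist_to P x2 y2) in *. set (q := dist_to P x1 y1) in *.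
  pose proof (Rabs_le_hypotenuse _ _ _ N S2) as X.
  pose proof (Rabs_le_hypotenuse _ _ _ N (eq_trans S2 (Rplus_comm _ _))) as Y.
  pose proof (Rabs_pos (x1 - x2)) as A0. pose proof (Rabs_pos (y1 - y2)) as B0.
  assert (QA : Rabs (x1 - x2) * Rabs (x1 - x2) = (x1 - x2) * (x1 - x2))
    by (symmetry; apply Rsqr_abs).
  assert (QB : Rabs (y1 - y2) * Rabs (y1 - y2) = (y1 - y2) * (y1 - y2))
    by (symmetry; apply Rsqr_abs).
  assert (C : forall a b, Rabs b <= r -> a * b <= Rabs a * r).
  { intros a b Hb. eapply Rle_trans; [apply Rle_abs|]. rewrite Rabs_mult.
    apply Rmult_le_compat_l; [apply Rabs_pos | exact Hb]. }
  pose proof (C (x1 - x2) _ X) as CA. pose proof (C (y1 - y2) _ Y) as CB.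
  pose proof (Rmult_le_pos _ _ A0 B0) as AB.
  apply Rsqr_incr_0_var; [|lra]. unfold Rsqr. rewrite S1.
  replace ((x1 - fst P) ^ 2 + (y1 - snd P) ^ 2) with
    ((x1 - x2) * (x1 - x2) + (y1 - y2) * (y1 - y2)
     + 2 * ((x1 - x2) * (x2 - fst P)) + 2 * ((y1 - y2) * (y2 - snd P))
     + ((x2 - fst P) ^ 2 + (y2 - snd P) ^ 2)) by ring.
  rewrite <- S2, <- QA, <- QB. lra.
Qed.

Lemma lipschitz_dist_to (P : R * R) (x y : R) : locally_lipschitz (dist_to P) x y.
Proof.
  exists 1, 1. split; [lra|]. split; [lra|]. intros x1 y1 x2 y2 _ _.
  pose proof (dist_to_triangle P x1 y1 x2 y2) as K1.
  pose proof (dist_to_triangle P x2 y2 x1 y1) as K2.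
  rewrite (Rabs_minus_sym x2), (Rabs_minus_sym y2) in K2.
  rewrite Rmult_1_l. apply Rabs_le. lra.
Qed.

(** The Newtonian factor [r^-3]. *)
Definition inv_dist_cube (P : R * R) (u v : R) : R :=
  / (dist_to P u v * (dist_to P u v * dist_to P u v)).

Lemma lipschitz_inv_dist_cube (P : R * R) (x y : R) :
  0 < dist_to P x y -> locally_lipschitz (inv_dist_cube P) x y.
Proof.
  intros H. apply (lipschitz_inv (fun u v => dist_to P u v * (dist_to P u v * dist_to P u v))).
  - now repeat apply Rmult_lt_0_compat.
  - apply (lipschitz_mult (dist_to P) (fun u v => dist_to P u v * dist_to P u v)).
    + apply lipschitz_dist_to.
    + apply (lipschitz_mult (dist_to P) (dist_to P)); apply lipschitz_dist_to.
Qed.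

(** The common shape of both components of the gradient. *)
Lemma lipschitz_attraction (k k1 k2 k3 : R -> R -> R) (x y : R) :
  dom_xy x y ->
  locally_lipschitz k x y -> locally_lipschitz k1 x y -> locally_lipschitz k2 x y ->
  locally_lipschitz k3 x y ->
  locally_lipschitz (fun u v => k u v + - (1 / 3) *
      (k1 u v * inv_dist_cube primary1 u v + k2 u v * inv_dist_cube primary2 u v
       + k3 u v * inv_dist_cube primary3 u v)) x y.
Proof.
  intros [H1 [H2 H3]] K K1 K2 K3.
  pose proof (lipschitz_mult _ _ _ _ K1 (lipschitz_inv_dist_cube _ _ _ H1)) as M1.
  pose proof (lipschitz_mult _ _ _ _ K2 (lipschitz_inv_dist_cube _ _ _ H2)) as M2.
  pose proof (lipschitz_mult _ _ _ _ K3 (lipschitz_inv_dist_cube _ _ _ H3)) as M3.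
  exact (lipschitz_plus _ _ _ _ K (lipschitz_scal (- (1 / 3)) _ _ _
    (lipschitz_plus _ _ _ _ (lipschitz_plus _ _ _ _ M1 M2) M3))).
Qed.

Lemma lipschitz_grad_x (x y : R) : dom_xy x y -> locally_lipschitz grad_x x y.
Proof.
  intros H. eapply lipschitz_ext.
  2:{ apply (lipschitz_attraction (fun u _ => u - 0) (fun u _ => u - fst primary1)
        (fun u _ => u - fst primary2) (fun u _ => u - fst primary3) x y H);
      apply lipschitz_coord_x. }
  intros u v. unfold grad_x, inv_dist_cube, Rdiv, pow. rewrite !Rmult_1_r. ring.
Qed.

Lemma lipschitz_grad_y (x y : R) : dom_xy x y -> locally_lipschitz grad_y x y.
Proof.
  intros H. eapply lipschitz_ext.
  2:{ apply (lipschitz_attraction (fun _ v => v - 0) (fun _ v => v - snd primary1)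
        (fun _ v => v - snd primary2) (fun _ v => v - snd primary3) x y H);
      apply lipschitz_coord_y. }
  intros u v. unfold grad_y, inv_dist_cube, Rdiv, pow. rewrite !Rmult_1_r. ring.
Qed.

(** * Uniqueness of solutions *)

Lemma is_derive_incr_le (w w' : R -> R) (s t : R) :
  s <= t -> (forall r, s <= r <= t -> is_derive w r (w' r)) ->
  (forall r, s <= r <= t -> 0 <= w' r) -> w s <= w t.
Proof.
  intros Hst Hd Hw.
  destruct Hst as [Hst | ->]; [|apply Rle_refl].
  destruct (MVT_cor2 w w' s t Hst) as [c [E Hc]].
  - intros r Hr. apply is_derive_Reals. now apply Hd.
  - specialize (Hw c ltac:(lra)). nra.
Qed.

(** Gronwall's inequality, with initial value zero and in both directions of time. *)
Lemma gronwall_zero (u u' : R -> R) (C a e : R) :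
  (forall t, Rabs (t - a) < e -> is_derive u t (u' t)) ->
  (forall t, 0 <= u t) ->
  (forall t, Rabs (t - a) < e -> Rabs (u' t) <= C * u t) ->
  u a = 0 -> forall t, Rabs (t - a) < e -> u t = 0.
Proof.
  intros Hd Hu Hb Ha t Ht.
  (* [u] times [exp (- C t)] is nonincreasing, and [u] times [exp (C t)] is nondecreasing. *)
  assert (W : forall k r, Rabs (r - a) < e ->
    is_derive (fun s => u s * exp (k * s)) r ((u' r + k * u r) * exp (k * r))).
  { intros k r Hr. evar_last.
    - apply (is_derive_mult u (fun s => exp (k * s)) r (u' r) (k * exp (k * r)) (Hd r Hr)).
      + auto_derive; [exact I | ring].
      + intros; apply Rmult_comm.
    - unfold plus, mult; simpl. ring. }
  assert (B : forall r, Rabs (r - a) < e -> - (C * u r) <= u' r <= C * u r).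
  { intros r Hr. apply Rabs_le_between, Hb, Hr. }
  apply Rabs_def2 in Ht.
  pose proof (exp_pos (C * t)) as X1. pose proof (exp_pos (- C * t)) as X2.
  pose proof (Hu t) as Hut.
  destruct (Rle_or_lt a t) as [Hat | Hat].
  - assert (I : - (u a * exp (- C * a)) <= - (u t * exp (- C * t))).
    { apply (is_derive_incr_le (fun s => - (u s * exp (- C * s)))
        (fun s => - ((u' s + - C * u s) * exp (- C * s))) a t Hat).
      - intros r Hr. apply (is_derive_opp (fun s => u s * exp (- C * s))), W, Rabs_def1; lra.
      - intros r Hr. pose proof (exp_pos (- C * r)).
        specialize (B r ltac:(apply Rabs_def1; lra)). nra. }
    rewrite Ha in I. nra.
  - assert (I : u t * exp (C * t) <= u a * exp (C * a)).
    { apply (is_derive_incr_le (fun s => u s * exp (C * s))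
        (fun s => (u' s + C * u s) * exp (C * s)) t a); [lra| |].
      - intros r Hr. apply W, Rabs_def1; lra.
      - intros r Hr. pose proof (exp_pos (C * r)).
        specialize (B r ltac:(apply Rabs_def1; lra)). nra. }
    rewrite Ha in I. nra.
Qed.

(** The line is connected: the zero set of a continuous function is closed, so
    it is everything as soon as it is also open and nonempty. *)
Lemma open_zero_set_right (u : R -> R) (a : R) :
  (forall t, continuous u t) ->
  (forall t, u t = 0 -> exists e, 0 < e /\ forall s, Rabs (s - t) < e -> u s = 0) ->
  u a = 0 -> forall b, a <= b -> u b = 0.
Proof.
  intros Hc Ho Ha b Hab.
  (* [m] is the end of the largest interval of zeros that starts at [a], cut off at [b]. *)
  destruct (completeness (fun t => a <= t <= b /\ forall s, a <= s <= t -> u s = 0))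
    as [m [Hub Hlub]].
  { exists b. intros t [Ht _]. lra. }
  { exists a. split; [lra|]. intros s Hs. now replace s with a by lra. }
  assert (Ham : a <= m).
  { apply Hub. split; [lra|]. intros s Hs. now replace s with a by lra. }
  assert (Hmb : m <= b) by (apply Hlub; intros t [Ht _]; lra).
  assert (Below : forall s, a <= s < m -> u s = 0).
  { intros s Hs. destruct (Req_dec (u s) 0) as [E | N]; [exact E|]. exfalso.
    assert (m <= s); [|lra]. apply Hlub. intros t [Ht Hz].
    apply Rnot_lt_le. intros Hst. apply N, Hz. lra. }
  assert (Hm : u m = 0).
  { destruct (Req_dec (u m) 0) as [E | N]; [exact E|]. exfalso.
    destruct Ham as [Ham | Ham]; [|congruence].
    assert (P : 0 < Rabs (u m)) by now apply Rabs_pos_lt.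
    destruct (Hc m (ball (u m) (mkposreal _ P)) (locally_ball _ _)) as [e He].
    pose proof (cond_pos e) as Pe.
    set (s := Rmax a (m - e / 2)).
    assert (Hs : a <= s < m /\ m - e / 2 <= s).
    { unfold s. split; [split; [apply Rmax_l | apply Rmax_lub_lt; lra] | apply Rmax_r]. }
    assert (Bs : ball m e s) by (apply Rabs_def1; unfold minus, plus, opp; simpl; lra).
    specialize (He s Bs). rewrite (Below s) in He by lra.
    unfold ball in He; simpl in He; unfold AbsRing_ball, abs, minus, plus, opp in He; simpl in He.
    rewrite Rplus_0_l, Rabs_Ropp in He. lra. }
  destruct (Ho m Hm) as [e [He Hz]].
  destruct Hmb as [Hmb | Hmb]; [exfalso | congruence].
  assert (Rmin b (m + e / 2) <= m); [|apply (Rlt_not_le (Rmin b (m + e / 2)) m);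
    [apply Rmin_glb_lt; lra | assumption]].
  apply Hub. split.
  - split; [apply Rmin_glb; lra | apply Rmin_l].
  - intros s [Hs1 Hs2]. pose proof (Rmin_r b (m + e / 2)).
    destruct (Rlt_or_le s m) as [Hsm | Hsm]; [apply Below; lra|].
    apply Hz, Rabs_def1; lra.
Qed.

Lemma open_zero_set (u : R -> R) (a : R) :
  (forall t, continuous u t) ->
  (forall t, u t = 0 -> exists e, 0 < e /\ forall s, Rabs (s - t) < e -> u s = 0) ->
  u a = 0 -> forall b, u b = 0.
Proof.
  intros Hc Ho Ha b.
  destruct (Rle_or_lt a b) as [Hab | Hab]; [now apply (open_zero_set_right u a)|].
  rewrite <- (Ropp_involutive b).
  apply (open_zero_set_right (fun t => u (- t)) (- a)); [| | |lra].
  - intros t. apply (continuous_comp (fun t => - t) u); [|apply Hc].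
    apply (continuous_opp (fun t : R => t)), continuous_id.
  - intros t Ht. destruct (Ho _ Ht) as [e [He Hz]]. exists e. split; [exact He|].
    intros s Hs. apply Hz. replace (- s - - t) with (- (s - t)) by ring. now rewrite Rabs_Ropp.
  - now rewrite Ropp_involutive.
Qed.

Lemma solution_coord (g : R -> state) (t : R) :
  is_solution g ->
  is_derive (fun s => pos_x (g s)) t (vel_x (g t)) /\
  is_derive (fun s => vel_x (g s)) t (2 * vel_y (g t) + grad_x (pos_x (g t)) (pos_y (g t))) /\
  is_derive (fun s => pos_y (g s)) t (vel_y (g t)) /\
  is_derive (fun s => vel_y (g s)) t (- 2 * vel_x (g t) + grad_y (pos_x (g t)) (pos_y (g t))).
Proof.
  intros H. destruct (H t) as [Hd Hg]. rewrite (f_eq _ Hd) in Hg.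
  split; [exact (is_derive_linear_comp pos_x g t _ is_linear_pos_x Hg)|].
  split; [exact (is_derive_linear_comp vel_x g t _ is_linear_vel_x Hg)|].
  split; [exact (is_derive_linear_comp pos_y g t _ is_linear_pos_y Hg)|].
  exact (is_derive_linear_comp vel_y g t _ is_linear_vel_y Hg).
Qed.

(** The squared Euclidean distance in phase space. *)
Definition sqr_dist (p q : state) : R :=
  (pos_x p - pos_x q) ^ 2 + (vel_x p - vel_x q) ^ 2
  + (pos_y p - pos_y q) ^ 2 + (vel_y p - vel_y q) ^ 2.

Lemma sqr_dist_nonneg (p q : state) : 0 <= sqr_dist p q.
Proof. unfold sqr_dist. repeat apply Rplus_le_le_0_compat; apply pow2_ge_0. Qed.

Lemma sqr_dist_0 (p q : state) : sqr_dist p q = 0 <-> p = q.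
Proof.
  split.
  - unfold sqr_dist. intros H.
    pose proof (pow2_ge_0 (pos_x p - pos_x q)). pose proof (pow2_ge_0 (vel_x p - vel_x q)).
    pose proof (pow2_ge_0 (pos_y p - pos_y q)). pose proof (pow2_ge_0 (vel_y p - vel_y q)).
    rewrite (state_eq p), (state_eq q).
    repeat apply (f_equal2 pair); apply Rminus_diag_uniq, Rsqr_0_uniq; rewrite Rsqr_pow2; lra.
  - intros ->. unfold sqr_dist. ring.
Qed.

(** The derivative of [sqr_dist] along two solutions. *)
Definition sqr_dist' (p q : state) : R :=
  2 * (pos_x p - pos_x q) * (vel_x p - vel_x q)
  + 2 * (vel_x p - vel_x q) * ((2 * vel_y p + grad_x (pos_x p) (pos_y p))
                               - (2 * vel_y q + grad_x (pos_x q) (pos_y q)))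
  + 2 * (pos_y p - pos_y q) * (vel_y p - vel_y q)
  + 2 * (vel_y p - vel_y q) * ((- 2 * vel_x p + grad_y (pos_x p) (pos_y p))
                               - (- 2 * vel_x q + grad_y (pos_x q) (pos_y q))).

Lemma is_derive_sqr_minus (a b : R -> R) (t a' b' : R) :
  is_derive a t a' -> is_derive b t b' ->
  is_derive (fun s => (a s - b s) ^ 2) t (2 * (a t - b t) * (a' - b')).
Proof.
  intros Ha Hb.
  pose proof (is_derive_minus _ _ _ _ _ Ha Hb) as H.
  evar_last.
  - exact (is_derive_pow _ 2 _ _ H).
  - unfold minus, plus, opp; simpl. ring.
Qed.

Lemma is_derive_sqr_dist (g h : R -> state) (t : R) :
  is_solution g -> is_solution h ->
  is_derive (fun s => sqr_dist (g s) (h s)) t (sqr_dist' (g t) (h t)).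
Proof.
  intros Hg Hh.
  destruct (solution_coord g t Hg) as [G1 [G2 [G3 G4]]].
  destruct (solution_coord h t Hh) as [H1 [H2 [H3 H4]]].
  pose proof (is_derive_sqr_minus _ _ _ _ _ G1 H1) as D1.
  pose proof (is_derive_sqr_minus _ _ _ _ _ G2 H2) as D2.
  pose proof (is_derive_sqr_minus _ _ _ _ _ G3 H3) as D3.
  pose proof (is_derive_sqr_minus _ _ _ _ _ G4 H4) as D4.
  exact (is_derive_plus _ _ _ _ _ (is_derive_plus _ _ _ _ _ (is_derive_plus _ _ _ _ _ D1 D2) D3) D4).
Qed.

Lemma Rabs_mult2_le (a b : R) : Rabs (2 * a * b) <= a ^ 2 + b ^ 2.
Proof.
  pose proof (pow2_ge_0 (a - b)). pose proof (pow2_ge_0 (a + b)).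
  apply Rabs_le. split; nra.
Qed.

Lemma Rabs_mult_lipschitz (L v w a b : R) :
  0 <= L -> Rabs w <= L * (Rabs a + Rabs b) -> Rabs (2 * v * w) <= L * (a ^ 2 + b ^ 2 + 2 * v ^ 2).
Proof.
  intros HL H.
  replace (2 * v * w) with (v * (2 * w)) by ring. rewrite !Rabs_mult, (Rabs_pos_eq 2) by lra.
  rewrite <- (pow2_abs a), <- (pow2_abs b), <- (pow2_abs v).
  pose proof (Rabs_pos v) as V. set (v' := Rabs v) in *. set (a' := Rabs a) in *.
  set (b' := Rabs b) in *. set (w' := Rabs w) in *. clearbody v' a' b' w'.
  apply Rle_trans with (v' * (2 * (L * (a' + b')))); [nra|].
  assert (0 <= L * ((a' - v') ^ 2 + (b' - v') ^ 2)).
  { apply Rmult_le_pos; [exact HL|]. apply Rplus_le_le_0_compat; apply pow2_ge_0. }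
  nra.
Qed.

(** The differential inequality to which Gronwall's lemma applies. *)
Lemma sqr_dist'_bound (L : R) (p q : state) :
  0 <= L ->
  Rabs (grad_x (pos_x p) (pos_y p) - grad_x (pos_x q) (pos_y q))
    <= L * (Rabs (pos_x p - pos_x q) + Rabs (pos_y p - pos_y q)) ->
  Rabs (grad_y (pos_x p) (pos_y p) - grad_y (pos_x q) (pos_y q))
    <= L * (Rabs (pos_x p - pos_x q) + Rabs (pos_y p - pos_y q)) ->
  Rabs (sqr_dist' p q) <= (1 + 2 * L) * sqr_dist p q.
Proof.
  intros HL Hx Hy.
  set (v1 := vel_x p - vel_x q). set (v2 := vel_y p - vel_y q).
  set (a := pos_x p - pos_x q) in *. set (b := pos_y p - pos_y q) in *.
  pose proof (Rabs_mult_lipschitz L v1 _ _ _ HL Hx) as K1.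
  pose proof (Rabs_mult_lipschitz L v2 _ _ _ HL Hy) as K2.
  pose proof (Rabs_mult2_le a v1) as K3.
  pose proof (Rabs_mult2_le b v2) as K4.
  set (wx := _ - _) in K1. set (wy := _ - _) in K2.
  (* The Coriolis terms cancel. *)
  assert (E : sqr_dist' p q = 2 * a * v1 + 2 * v1 * wx + (2 * b * v2 + 2 * v2 * wy)).
  { unfold sqr_dist', wx, wy, v1, v2, a, b. ring. }
  rewrite E. unfold sqr_dist. fold v1 v2 a b.
  eapply Rle_trans; [apply Rabs_triang|].
  pose proof (Rabs_triang (2 * a * v1) (2 * v1 * wx)).
  pose proof (Rabs_triang (2 * b * v2) (2 * v2 * wy)).
  clearbody v1 v2 wx wy a b.
  lra.
Qed.

Lemma continuous_coord_near (g : R -> R) (t l d : R) :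
  is_derive g t l -> 0 < d ->
  exists e, 0 < e /\ forall s, Rabs (s - t) < e -> Rabs (g s - g t) < d.
Proof.
  intros H Hd.
  assert (Hc : continuous g t) by (apply (ex_derive_continuous g); now exists l).
  destruct (Hc (ball (g t) (mkposreal d Hd)) (locally_ball _ _)) as [e He].
  exists e. split; [apply cond_pos|]. exact He.
Qed.

Lemma solution_near (g : R -> state) (t d : R) :
  is_solution g -> 0 < d ->
  exists e, 0 < e /\ forall s, Rabs (s - t) < e ->
    near d (pos_x (g t)) (pos_y (g t)) (pos_x (g s)) (pos_y (g s)).
Proof.
  intros H Hd. destruct (solution_coord g t H) as [H1 [_ [H2 _]]].
  destruct (continuous_coord_near _ _ _ d H1 Hd) as [e1 [P1 C1]].
  destruct (continuous_coord_near _ _ _ d H2 Hd) as [e2 [P2 C2]].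
  exists (Rmin e1 e2). split; [now apply Rmin_glb_lt|]. intros s Hs. split.
  - apply C1. eapply Rlt_le_trans; [exact Hs | apply Rmin_l].
  - apply C2. eapply Rlt_le_trans; [exact Hs | apply Rmin_r].
Qed.

Lemma solution_unique_local (g h : R -> state) (t : R) :
  is_solution g -> is_solution h -> g t = h t ->
  exists e, 0 < e /\ forall s, Rabs (s - t) < e -> sqr_dist (g s) (h s) = 0.
Proof.
  intros Hg Hh E.
  pose proof (proj1 (dom_f_xy _) (proj1 (Hg t))) as D.
  destruct (lipschitz_grad_x _ _ D) as [d1 [L1 [P1 [N1 B1]]]].
  destruct (lipschitz_grad_y _ _ D) as [d2 [L2 [P2 [N2 B2]]]].
  set (d := Rmin d1 d2).
  assert (Pd : 0 < d) by now apply Rmin_glb_lt.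
  destruct (solution_near g t d Hg Pd) as [e1 [Pe1 C1]].
  destruct (solution_near h t d Hh Pd) as [e2 [Pe2 C2]].
  rewrite <- E in C2.
  exists (Rmin e1 e2). split; [now apply Rmin_glb_lt|].
  apply (gronwall_zero _ (fun s => sqr_dist' (g s) (h s)) (1 + 2 * Rmax L1 L2)).
  - intros s _. now apply is_derive_sqr_dist.
  - intros s. apply sqr_dist_nonneg.
  - intros s Hs.
    specialize (C1 s (Rlt_le_trans _ _ _ Hs (Rmin_l _ _))).
    specialize (C2 s (Rlt_le_trans _ _ _ Hs (Rmin_r _ _))).
    apply sqr_dist'_bound.
    + apply Rle_trans with L1; [exact N1 | apply Rmax_l].
    + eapply Rle_trans; [apply B1; eapply near_le; try eassumption; apply Rmin_l|].
      apply Rmult_le_compat_r; [|apply Rmax_l].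
      apply Rplus_le_le_0_compat; apply Rabs_pos.
    + eapply Rle_trans; [apply B2; eapply near_le; try eassumption; apply Rmin_r|].
      apply Rmult_le_compat_r; [|apply Rmax_r].
      apply Rplus_le_le_0_compat; apply Rabs_pos.
  - now apply sqr_dist_0.
Qed.

Lemma solution_unique (g h : R -> state) (a : R) :
  is_solution g -> is_solution h -> g a = h a -> forall t, g t = h t.
Proof.
  intros Hg Hh E t. apply sqr_dist_0.
  apply (open_zero_set (fun s => sqr_dist (g s) (h s)) a).
  - intros s. apply (ex_derive_continuous (fun s => sqr_dist (g s) (h s))).
    eexists. now apply is_derive_sqr_dist.
  - intros s Hs. apply solution_unique_local; [assumption | assumption | now apply sqr_dist_0].
  - now apply sqr_dist_0.
Qed.

(** * Distinctness of the orbits *)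

Lemma is_solution_shift (g : R -> state) (s : R) :
  is_solution g -> is_solution (fun t => g (t + s)).
Proof.
  intros H t. destruct (H (t + s)) as [Hd Hg]. split; [exact Hd|].
  evar_last.
  - apply (is_derive_comp g (fun t => t + s) t (Defs.f (g (t + s))) 1 Hg).
    auto_derive; [exact I | ring].
  - apply (scal_one (Defs.f (g (t + s)))).
Qed.

Lemma periodic_limit_const (x0 : state) (g : R -> state) (T : R) :
  0 < T -> (forall t, g (t + T) = g t) -> filterlim g (Rbar_locally p_infty) (locally x0) ->
  forall t, g t = x0.
Proof.
  intros HT Hp Hl t.
  assert (E : forall n, g (t + INR n * T) = g t).
  { induction n as [|n IH]; [simpl; f_equal; ring|].
    rewrite <- IH, <- (Hp (t + INR n * T)), S_INR. f_equal. ring. }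
  apply (@filterlim_locally_unique nat _ _ eventually _ (fun n => g (t + INR n * T))).
  - intros P HP. exists 0%nat. intros n _. rewrite E. exact (locally_singleton _ P HP).
  - apply (filterlim_comp _ _ _ (fun n => t + INR n * T) g _ (Rbar_locally p_infty)); [|exact Hl].
    intros P [M HM].
    destruct (nfloor_ex (Rmax 0 ((M - t) / T)) (Rmax_l _ _)) as [N [_ HN]].
    exists (S N). intros n Hn. apply HM.
    assert (K : (M - t) / T < INR n).
    { apply Rle_lt_trans with (1 := Rmax_r 0 _). apply Rlt_le_trans with (1 := HN).
      rewrite <- S_INR. now apply le_INR. }
    apply (Rmult_lt_compat_r T) in K; [|exact HT].
    replace ((M - t) / T * T) with (M - t) in K by (field; lra). lra.
Qed.

Lemma homoclinic_not_const (x0 x1 : state) (g : R -> state) :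
  homoclinic x0 g -> ~ forall t, g t = x1.
Proof.
  intros [_ [_ [[s [t Hst]] _]]] H. apply Hst. now rewrite !H.
Qed.

Lemma homoclinic_not_periodic (x0 : state) (g : R -> state) (T : R) :
  homoclinic x0 g -> T <> 0 -> ~ forall t, g (t + T) = g t.
Proof.
  intros Hg HT Hp. apply (homoclinic_not_const x0 x0 g Hg).
  destruct Hg as [_ [_ [_ [Hl _]]]].
  destruct (Rdichotomy _ _ HT) as [H | H].
  - apply (periodic_limit_const x0 g (- T)); [lra | | exact Hl].
    intros t. rewrite <- (Hp (t + - T)). f_equal. ring.
  - now apply (periodic_limit_const x0 g T).
Qed.

Lemma distinct_phi_plus (x0 : state) (g : R -> state) :
  homoclinic x0 g -> distinct_orbits (fun t => phi_plus (g t)) g.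
Proof.
  intros Hg H.
  destruct (proj1 (H (phi_plus (g 0)))) as [s Hs]; [now exists 0|].
  assert (Sol : is_solution g) by apply Hg.
  (* Both sides solve the equation and agree at time 0. *)
  assert (E : forall t, phi_plus (g t) = g (t + s)).
  { apply (solution_unique _ _ 0); [now apply is_solution_phi_plus | now apply is_solution_shift|].
    now rewrite Rplus_0_l. }
  destruct (Req_dec s 0) as [-> | N].
  - apply (homoclinic_not_const x0 (0, 0, 0, 0) g Hg). intros t.
    apply phi_plus_fixed. rewrite E. f_equal. ring.
  - apply (homoclinic_not_periodic x0 g (3 * s) Hg); [lra|]. intros t.
    rewrite <- (phi_plus_cube (g t)), !E. f_equal. ring.
Qed.

Lemma distinct_orbits_sym (g h : R -> state) : distinct_orbits g h -> distinct_orbits h g.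
Proof. intros H E. apply H. intros p. symmetry. apply E. Qed.

Lemma distinct_orbits_ext (g g' h h' : R -> state) :
  (forall t, g t = g' t) -> (forall t, h t = h' t) -> distinct_orbits g h -> distinct_orbits g' h'.
Proof.
  intros Eg Eh H E. apply H. intros p.
  assert (K : forall k k' : R -> state, (forall t, k t = k' t) -> orbit k p <-> orbit k' p).
  { intros k k' Ek. split; intros [t Ht]; exists t; congruence. }
  rewrite (K g g' Eg), (K h h' Eh). apply E.
Qed.

(** * Homoclinic orbits under the rotations *)

Theorem lemma1 :
  rotational_conjugacy phi_plus /\
  rotational_conjugacy phi_minus /\
  (forall gamma : R -> state,
     homoclinic L0 gamma ->
     homoclinic L0 (fun t => phi_plus (gamma t)) /\
     homoclinic L0 (fun t => phi_minus (gamma t)) /\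
     distinct_orbits (fun t => phi_plus (gamma t)) (fun t => phi_minus (gamma t)) /\
     distinct_orbits (fun t => phi_plus (gamma t)) gamma /\
     distinct_orbits (fun t => phi_minus (gamma t)) gamma) /\
  (forall L4 L5 L6 : state,
     is_L4 L4 -> is_L5 L5 -> is_L6 L6 ->
     forall gamma : R -> state,
       homoclinic L5 gamma ->
       homoclinic L6 (fun t => phi_plus (gamma t)) /\
       homoclinic L4 (fun t => phi_minus (gamma t))).
Proof.
  split; [exact conjugacy_phi_plus|]. split; [exact conjugacy_phi_minus|]. split.
  - intros g Hg.
    pose proof (homoclinic_phi_plus _ _ Hg) as Hp.
    pose proof (homoclinic_phi_minus _ _ Hg) as Hm.
    assert (E : phi_minus L0 = L0) by (unfold L0; now rewrite phi_minus_eq, !phi_plus_0).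
    rewrite E in Hm. replace (phi_plus L0) with L0 in Hp by (symmetry; apply phi_plus_0).
    split; [exact Hp|]. split; [exact Hm|]. split; [|split].
    + apply distinct_orbits_sym.
      apply (distinct_orbits_ext (fun t => phi_plus (phi_plus (g t))) _ (fun t => phi_plus (g t)) _);
        [intros t; now rewrite phi_minus_eq | reflexivity |].
      apply (distinct_phi_plus L0 (fun t => phi_plus (g t)) Hp).
    + apply (distinct_phi_plus L0 g Hg).
    + apply distinct_orbits_sym.
      apply (distinct_orbits_ext (fun t => phi_plus (phi_minus (g t))) _ (fun t => phi_minus (g t)) _);
        [intros t; now rewrite phi_minus_eq, phi_plus_cube | reflexivity |].
      apply (distinct_phi_plus L0 (fun t => phi_minus (g t)) Hm).
  - intros p4 p5 p6 H4 H5 H6 g Hg.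
    assert (E4 : phi_minus p5 = p4).
    { rewrite (outer_equilibrium_0_unique p5 (phi_plus p4) H5 (phi_plus_outer p4 H4)).
      rewrite phi_minus_eq. apply phi_plus_cube. }
    assert (E6 : phi_plus p5 = p6).
    { rewrite (outer_equilibrium_0_unique p5 (phi_minus p6) H5 (phi_minus_outer p6 H6)).
      rewrite phi_minus_eq. apply phi_plus_cube. }
    rewrite <- E4, <- E6. split.
    + now apply homoclinic_phi_plus.
    + now apply homoclinic_phi_minus.
Qed.
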